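(* Let $\rho$ be a probability distribution on $\mathbb{R}^d\times\mathbb{R}$ with $\mathbb{E}\|a\|^2<\infty$ and $\mathbb{E}[b^2]<\infty$ for $(a,b)\sim\rho$, with $H=\mathbb{E}[aa^\top]$ invertible, and let $x_*$ be the unique minimizer of $\mathcal{R}(x)=\frac12\mathbb{E}_\rho(\langle x,a\rangle-b)^2$. Assume there are finite constants $\sigma,\kappa$ with (i) $\mathbb{E}[(b-\langle x_*,a\rangle)^2 aa^\top]\preccurlyeq \sigma^2 H$, and (ii) for every positive semidefinite matrix $M$, $\mathbb{E}[\langle a,Ma\rangle\, aa^\top]\preccurlyeq \kappa\,\mathrm{tr}(MH)\,H$. Run the algorithm AcSGD described in the context with step sizes $\alpha,\beta>0$ satisfying $\kappa(\alpha+2\beta)\mathrm{tr}(H)\le1$ and $\alpha\le\frac{\beta}{2\kappa d}$. Then for every integer $t\ge1$, the last iterate satisfies $$\mathbb{E}[\mathcal{R}(x_t)]-\mathcal{R}(x_* )\le \min\left\{\frac{3}{\alpha t^2},\frac{24}{\beta t}\right\}\|x_0-x_*\|^2+2\left((\alpha+2\beta)\mathrm{tr}(H)+\frac{2\alpha d}{\beta}\right)\sigma^2.$$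
   Context: $\preccurlyeq$ is the Loewner order on symmetric matrices. Samples $(a_t,b_t)_{t\ge0}$ are drawn i.i.d. from $\rho$. AcSGD: given $x_0\in\mathbb{R}^d$, set $z_0=x_0$ and for $t\ge0$ let $g_t=a_t(\langle a_t,x_t\rangle-b_t)$ and $y_{t+1}=x_t-\beta g_t$, $z_{t+1}=z_t-\alpha(t+1)g_t$, $(t+2)x_{t+1}=(t+1)y_{t+1}+z_{t+1}$. Expectation is over the samples. *)

(* Defs.v *)
From HB Require Import structures.
From mathcomp Require Import all_boot all_order all_algebra.
From mathcomp Require Import all_classical all_reals all_analysis.
Set Implicit Arguments. Unset Strict Implicit. Unset Printing Implicit Defensive.
Import Order.TTheory GRing.Theory Num.Theory.
Local Open Scope ring_scope.

Section Defs.
Context {R : realType} {d : nat} {dT : measure_display} {T : measurableType dT}.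
Variable P : probability T R.

Definition dot (u v : 'rV[R]_d) : R := (u *m v^T) 0 0.
Definition sqnorm (u : 'rV[R]_d) : R := dot u u.

Definition E (f : T -> R) : R := Rintegral P setT f.

(* H = E[a a^T] (entrywise expectation), for samples (a,b) = (A z, B z), z ~ P. *)
Definition Hmat (A : T -> 'rV[R]_d) : 'M[R]_d :=
  \matrix_(i, j) E (fun z => A z 0 i * A z 0 j).

Definition risk (A : T -> 'rV[R]_d) (B : T -> R) (x : 'rV[R]_d) : \bar R :=
  (\int[P]_(z in setT) ((2%:R)^-1 * (dot x (A z) - B z) ^+ 2)%:E)%E.

(* Expectation over n i.i.d. samples z_0, ..., z_{n-1} ~ P of a nonnegative
   functional f of the sample list [:: z_0; ...; z_{n-1}]: iterated integral
   (equal to the integral w.r.t. the n-fold product measure, by Tonelli). *)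
Fixpoint Eiter (n : nat) (f : seq T -> \bar R) : \bar R :=
  match n with
  | 0 => f [::]
  | n'.+1 => (\int[P]_(z in setT) Eiter n' (fun s => f (z :: s)))%E
  end.
End Defs.

Fixpoint acsgd_run {R : realType} {d : nat} (alpha beta : R) (t : nat)
    (x z : 'rV[R]_d) (s : seq ('rV[R]_d * R)) : 'rV[R]_d :=
  match s with
  | [::] => x
  | (a, b) :: s' =>
      let g := (dot a x - b) *: a in
      let y' := x - beta *: g in
      let z' := z - (alpha * t.+1%:R) *: g in
      let x' := (t.+2%:R)^-1 *: (t.+1%:R *: y' + z') in
      acsgd_run alpha beta t.+1 x' z' s'
  end.

Definition acsgd {R : realType} {d : nat} (alpha beta : R) (x0 : 'rV[R]_d)
  (s : seq ('rV[R]_d * R)) : 'rV[R]_d := acsgd_run alpha beta 0 x0 x0 s.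

Definition psd {R : realType} {d : nat} (M : 'M[R]_d) : Prop :=
  M^T = M /\ forall v : 'rV[R]_d, 0 <= (v *m M *m v^T) 0 0.

(* Main.v *)
Require Import Defs.
From HB Require Import structures.
From mathcomp Require Import all_boot all_order all_algebra.
From mathcomp Require Import complex.
From mathcomp Require Import all_classical all_reals all_analysis.
From mathcomp Require Import measurable_realfun ring lra.
Set Implicit Arguments. Unset Strict Implicit. Unset Printing Implicit Defensive.
Import Order.TTheory GRing.Theory Num.Theory.
Local Open Scope ring_scope.

(* In the variables X = (t + 1) (x_t - xstar) and Z = z_t - xstar, a step of
   AcSGD is a time-invariant linear map with multiplicative noise, plus a
   centred additive noise of size t + 1; the excess risk is
   <X, H X> / (2 (t + 1)^2).  In an eigenframe of H the averaged dynamics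
   decouples into scalar recursions [resp].  By hypothesis (ii), the
   multiplicative noise injected by a step contributes, k steps later, at most
   kappa * kernel k times the current <X, H X>, so that the expected risk
   satisfies a Volterra inequality.  A Lyapunov function of the scalar recursion
   gives kappa * \sum_k kernel k <= 2 / 3, which keeps the expected risk within
   three times the risk of the averaged dynamics.  The inequality is propagated
   backwards in time on value functions of the starting point, of the form
   quadratic + linear + constant: the cross terms between the two noises are
   linear in the state, and are only bounded at the end, using that the excess
   risk is nonnegative. *)

(** * The scalar recursion of one eigendirection *)

Section Response.
Context {R : realFieldType}.
Variables (alpha beta : R).

Fixpoint resp (lam : R) (k : nat) (x z : R) : R :=
  if k is k'.+1 then
    resp lam k' ((1 - (alpha + beta) * lam) * x + z) (z - alpha * lam * x)
  else x.

Lemma resp_comb lam k c x z y w :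
  resp lam k (x + c * y) (z + c * w) = resp lam k x z + c * resp lam k y w.
Proof.
elim: k x z y w => [//|k IH] x z y w /=.
by rewrite -IH; congr resp; ring.
Qed.

Lemma resp_scale lam k c x z :
  resp lam k (c * x) (c * z) = c * resp lam k x z.
Proof.
have := resp_comb lam k c 0 0 x z; rewrite !add0r => ->.
by have := resp_comb lam k (-1) 0 0 0 0; rewrite !mulr0 !addr0; lra.
Qed.

Context (alpha_gt0 : 0 < alpha) (beta_gt0 : 0 < beta)
  (alpha_le : 2 * alpha <= beta).
Variable lam : R.
Hypotheses (lam_ge0 : 0 <= lam) (lam_le : (alpha + 2 * beta) * lam <= 1).

Lemma step_facts : [/\ 0 <= alpha * lam, 0 <= beta * lam,
  2 * (alpha * lam) <= beta * lam & alpha * lam + 2 * (beta * lam) <= 1].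
Proof.
split; [by rewrite mulr_ge0// ltW | by rewrite mulr_ge0// ltW | |].
  by rewrite mulrA ler_wpM2r.
by move: lam_le; rewrite mulrDl -mulrA.
Qed.

(* The quadratic form on the right drops by
   [alpha * beta * lam ^+ 2 * (4 - (alpha + 2 * beta) * lam) * x ^+ 2] at
   each step. *)
Lemma resp_energy k x z :
  3 * (alpha * beta * lam ^+ 2) * \sum_(j < k) resp lam j x z ^+ 2 <=
  2 * (alpha * lam) * x ^+ 2 - 2 * (alpha * lam) * (x * z)
    + (2 - beta * lam) * z ^+ 2.
Proof.
have [al_ge0 bl_ge0 al_le lam_le'] := step_facts.
elim: k x z => [|k IH] x z.
  rewrite big_ord0 mulr0.
  have h1 : 0 <= alpha * lam * (x - z) ^+ 2 by rewrite mulr_ge0// sqr_ge0.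
  have h2 : 0 <= alpha * lam * x ^+ 2 by rewrite mulr_ge0// sqr_ge0.
  have h3 : 0 <= (2 - beta * lam - alpha * lam) * z ^+ 2.
    by rewrite mulr_ge0 ?sqr_ge0//; lra.
  suff : 0 <= alpha * lam * (x - z) ^+ 2 + alpha * lam * x ^+ 2
    + (2 - beta * lam - alpha * lam) * z ^+ 2 by congr (0 <= _); ring.
  by rewrite !addr_ge0.
rewrite big_ord_recl mulrDr /=.
have := IH ((1 - (alpha + beta) * lam) * x + z) (z - alpha * lam * x).
set S := \sum_(_ < _) _ => h.
(* The drop of the form exceeds the required [3 * (alpha * beta * lam ^+ 2) * x ^+ 2] by exactly
   this slack. *)
have h4 : 0 <= alpha * lam * (beta * lam)
    * (1 - alpha * lam - 2 * (beta * lam)) * x ^+ 2.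
  by apply: mulr_ge0 (sqr_ge0 _); apply: mulr_ge0; [exact: mulr_ge0 | lra].
rewrite -subr_ge0 in h; rewrite -subr_ge0.
have := addr_ge0 h h4.
by congr (0 <= _); ring.
Qed.

(** A unit gradient along an eigenvector shifts [x] by [- (alpha + beta)] and [z] by [- alpha],
    whence this start. The right-hand side is the form of [resp_energy] there, divided by
    [3 * (alpha * beta)]. *)
Lemma resp_noise_sum k :
  lam ^+ 2 * (\sum_(j < k) resp lam j (alpha + beta) alpha ^+ 2) <=
  (2 * alpha / beta + (alpha + 2 * beta) * lam) / 3.
Proof.
have ab_gt0 : 0 < 3 * (alpha * beta) by rewrite !mulr_gt0.
rewrite -(ler_pM2l ab_gt0).
have := resp_energy k (alpha + beta) alpha.
set S := \sum_(_ < _) _ => h.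
rewrite mulrA -mulrA -[3 * (alpha * beta) * (lam ^+ 2 * S)]mulrA in h *.
apply: le_trans (le_trans h _); first by rewrite !mulrA.
rewrite le_eqVlt; apply/orP; left; apply/eqP.
by field; rewrite gt_eqF.
Qed.

Definition energy x z : R := z ^+ 2 + alpha * lam * (x - z) ^+ 2.

(** The last square is the value of [z ^+ 2] after a step, so it cancels in [energy_step]; the first
    term is the one that [resp_accel] keeps. *)
Lemma energy_split x z : energy x z =
  alpha * lam * (1 - alpha * lam) * x ^+ 2 + alpha * lam * z ^+ 2
    + (z - alpha * lam * x) ^+ 2.
Proof. by rewrite /energy; ring. Qed.

Lemma energy_step x z :
  energy ((1 - (alpha + beta) * lam) * x + z) (z - alpha * lam * x)
    <= energy x z.
Proof.
have [al_ge0 bl_ge0 al_le lam_le'] := step_facts.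
rewrite energy_split /energy.
have h1 : 0 <= alpha * lam * z ^+ 2 by rewrite mulr_ge0// sqr_ge0.
have h2 : 0 <= alpha * lam * (2 * (beta * lam) - alpha * lam
    - (beta * lam) * (beta * lam)) * x ^+ 2.
  have : beta * lam * (beta * lam) <= beta * lam * 1.
    by rewrite ler_wpM2l//; lra.
  by move=> ?; apply: mulr_ge0 (sqr_ge0 _); apply: mulr_ge0 => //; lra.
rewrite -subr_ge0.
by have := addr_ge0 h1 h2; congr (0 <= _); ring.
Qed.

Lemma resp_accel k x z : alpha * lam * (1 - alpha * lam) * resp lam k x z ^+ 2
  <= energy x z.
Proof.
have [al_ge0 bl_ge0 al_le lam_le'] := step_facts.
elim: k x z => [|k IH] x z /=; last exact: le_trans (IH _ _) (energy_step _ _).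
rewrite energy_split -addrA lerDl addr_ge0 ?sqr_ge0//.
by rewrite mulr_ge0// sqr_ge0.
Qed.

(** A step turns [x - z] into [(1 - beta * lam) * x], and $|z| \le 1$ by the energy, so $|x - z|$
    grows by at most 1 per step. The third hypothesis is preserved and gives $\beta \lambda |x| \le
    1$, which leaves a single factor $|x|$, linear in [k]. *)
Lemma resp_damped k m x z : energy x z <= 1 -> `|x - z| <= m ->
    beta * lam * `|x - z| <= 1 - beta * lam ->
  beta * lam * resp lam k x z ^+ 2 <= m + k.+1%:R.
Proof.
have [al_ge0 bl_ge0 al_le lam_le'] := step_facts.
elim: k m x z => [|k IH] m x z he hm hb /=.
all: have z1 : `|z| <= 1
  by rewrite -(@ler_pXn2r _ 2)// ?nnegrE// expr1n real_normK ?num_real//;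
     apply: le_trans he; rewrite /energy lerDl mulr_ge0// sqr_ge0.
all: have xz : `|x| <= `|x - z| + `|z| by rewrite -{1}(subrK z x) ler_normD.
all: have bx : beta * lam * `|x| <= 1
  by apply: (le_trans (ler_wpM2l bl_ge0 xz)); rewrite mulrDr;
     have := ler_wpM2l bl_ge0 z1; lra.
- rewrite -[x ^+ 2]real_normK ?num_real// expr2 mulrA.
  by have := ler_wpM2r (normr_ge0 x) bx; lra.
- have -> : m + k.+2%:R = (m + 1) + k.+1%:R by rewrite -addrA -natr1; ring.
  have e : (1 - (alpha + beta) * lam) * x + z - (z - alpha * lam * x)
    = (1 - beta * lam) * x by ring.
  have p : 0 <= 1 - beta * lam by lra.
  apply: IH; rewrite ?e ?normrM ?(ger0_norm p).
  + exact: le_trans (energy_step _ _) he.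
  + have : (1 - beta * lam) * `|x| <= 1 * `|x| by rewrite ler_wpM2r//; lra.
    by lra.
  + by have := ler_wpM2l p bx; rewrite mulr1; apply: le_trans; rewrite mulrCA.
Qed.

End Response.

(** * Dot products and eigenframes *)

(* Real and imaginary parts of the rows of a unitary diagonalization: a
   Parseval frame of real eigenvectors, which serves as an orthonormal
   eigenbasis would. *)
Lemma symmetric_eigenframe (R : rcfType) n (H : 'M[R]_n) : H^T = H ->
  exists (w : 'I_n * bool -> 'rV[R]_n) (lam : 'I_n * bool -> R),
    (forall i, w i *m H = lam i *: w i) /\ \sum_i (w i)^T *m w i = 1%:M.
Proof.
move=> Hsym.
have ReS (I : finType) (F : I -> R[i]) :
    complex.Re (\sum_i F i) = \sum_i complex.Re (F i).
  by apply: (big_morph (@complex.Re R)) => // -[? ?] [? ?].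
have ImS (I : finType) (F : I -> R[i]) :
    complex.Im (\sum_i F i) = \sum_i complex.Im (F i).
  by apply: (big_morph (@complex.Im R)) => // -[? ?] [? ?].
pose A : 'M[R[i]]_n := \matrix_(i, j) (H i j)%:C%C.
have Areal : A \is a mxOver Num.real.
  by apply/mxOverP => i j; rewrite mxE; apply/complex_realP; exists (H i j).
have Asym : A \is hermsymmx.
  apply: realsym_hermsym => //; apply/is_hermitianmxP.
  by rewrite expr0 scale1r map_mx_id//; apply/matrixP => i j;
     rewrite !mxE -[in RHS]Hsym mxE.
pose P := spectralmx A; pose D := spectral_diag A.
have Pu : P \is unitarymx by exact: spectral_unitarymx.
have AE : P *m A = diag_mx D *m P.
  rewrite [in LHS](orthomx_spectralP (hermitian_normalmx Asym)).
  by rewrite -!mulmxA mulKVmx ?unitarymx_unit.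
have DE j : D 0 j = (complex.Re (D 0 j))%:C%C.
  by apply/esym/RRe_real/(mxOverP (hermitian_spectral_diag_real Asym)).
have PP : (map_mx Num.conj P^T) *m P = 1%:M.
  by rewrite -invmx_unitary// mulVmx// unitarymx_unit.
(* As [A] and its eigenvalues are real, the real and imaginary parts of a row of [P] satisfy the
   eigenvector equation separately. *)
exists (fun i =>
  \row_j if i.2 then complex.Re (P i.1 j) else complex.Im (P i.1 j)).
exists (fun i => complex.Re (D 0 i.1)); split=> [[i b]|].
  apply/rowP => j; rewrite !mxE /=.
  have := congr1 (fun M : 'M[R[i]]_n => M i j) AE.
  rewrite mul_diag_mx !mxE /= DE.
  case: b => e.
    have := congr1 (@complex.Re R) e; rewrite ReS /=.
    case: (P i j) => p q /=; rewrite mul0r subr0 => <-.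
    by apply: eq_bigr => k _; rewrite !mxE; case: (P i k) => ? ? /=;
       rewrite mulr0 subr0.
  have := congr1 (@complex.Im R) e; rewrite ImS /=.
  case: (P i j) => p q /=; rewrite mul0r addr0 => <-.
  by apply: eq_bigr => k _; rewrite !mxE; case: (P i k) => ? ? /=;
     rewrite mulr0 add0r.
apply/matrixP => j k; rewrite summxE.
(* The real part of $P^* P = 1$ is the frame identity. *)
have := congr1 (fun M : 'M[R[i]]_n => complex.Re (M j k)) PP.
rewrite !mxE ReS /= => e.
have <- : complex.Re (j == k)%:R = (j == k)%:R :> R by case: (j == k).
rewrite -e; transitivity (\sum_i \sum_(b : bool)
    (if b then complex.Re (P i j) else complex.Im (P i j))
    * (if b then complex.Re (P i k) else complex.Im (P i k))).
  by rewrite pair_bigA /=; apply: eq_bigr => i _; rewrite !mxE big_ord1 !mxE.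
apply: eq_bigr => i _; rewrite big_bool !mxE /=.
by case: (P i j) (P i k) => [p q] [p' q'] /=; rewrite mulNr opprK.
Qed.

Section Dot.
Context {R : realType} {d : nat}.
Implicit Types (u v w : 'rV[R]_d) (M : 'M[R]_d).

Lemma dotE u v : dot u v = \sum_i u 0 i * v 0 i.
Proof. by rewrite /dot mxE; apply: eq_bigr => i _; rewrite mxE. Qed.

Lemma dotC u v : dot u v = dot v u.
Proof. by rewrite !dotE; apply: eq_bigr => i _; rewrite mulrC. Qed.

Lemma dotDr u v w : dot u (v + w) = dot u v + dot u w.
Proof. by rewrite /dot linearD mulmxDr mxE. Qed.

Lemma dotZr u v c : dot u (c *: v) = c * dot u v.
Proof. by rewrite /dot linearZ /= -scalemxAr mxE. Qed.

Lemma dotNr u v : dot u (- v) = - dot u v.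
Proof. by rewrite -scaleN1r dotZr mulN1r. Qed.

Lemma dotDl u v w : dot (u + v) w = dot u w + dot v w.
Proof. by rewrite !(dotC _ w) dotDr. Qed.

Lemma dotZl u v c : dot (c *: u) v = c * dot u v.
Proof. by rewrite !(dotC _ v) dotZr. Qed.

Lemma dotNl u v : dot (- u) v = - dot u v.
Proof. by rewrite !(dotC _ v) dotNr. Qed.

Lemma dot0r u : dot u 0 = 0.
Proof. by rewrite -(scale0r (0 : 'rV[R]_d)) dotZr mul0r. Qed.

Lemma dot_sumr (I : finType) u (F : I -> 'rV[R]_d) :
  dot u (\sum_i F i) = \sum_i dot u (F i).
Proof. by apply: (big_morph (dot u)) => [v w|]; rewrite ?dotDr ?dot0r. Qed.

Lemma dot_suml (I : finType) u (F : I -> 'rV[R]_d) :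
  dot (\sum_i F i) u = \sum_i dot (F i) u.
Proof. by rewrite dotC dot_sumr; under eq_bigr do rewrite dotC. Qed.

Lemma sqnorm_ge0 u : 0 <= sqnorm u.
Proof. by rewrite /sqnorm dotE sumr_ge0// => i _; rewrite -expr2 sqr_ge0. Qed.

Lemma sqnorm_eq0 u : (sqnorm u == 0) = (u == 0).
Proof.
apply/eqP/eqP => [u0|->]; last exact: dot0r.
apply/rowP => i; rewrite mxE; apply/eqP; rewrite -sqrf_eq0 expr2.
move: u0; rewrite /sqnorm dotE => /eqP.
rewrite psumr_eq0 => [|j _]; last by rewrite -expr2 sqr_ge0.
by move=> /allP/(_ i (mem_index_enum _)).
Qed.

Lemma cauchy_schwarz u v : dot u v ^+ 2 <= sqnorm u * sqnorm v.
Proof.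
have [->|v0] := eqVneq v 0; first by rewrite !dot0r expr0n mulr_ge0 ?sqnorm_ge0.
have sv_gt0 : 0 < sqnorm v by rewrite lt_neqAle sqnorm_ge0 eq_sym sqnorm_eq0 v0.
have := sqnorm_ge0 (sqnorm v *: u - dot u v *: v).
have -> : sqnorm (sqnorm v *: u - dot u v *: v)
  = sqnorm v * (sqnorm u * sqnorm v - dot u v ^+ 2).
  rewrite {1}/sqnorm !(dotDl, dotDr, dotNl, dotNr, dotZl, dotZr) (dotC v u).
  by rewrite -!/(sqnorm _); ring.
by rewrite pmulr_rge0// subr_ge0.
Qed.

Lemma dot_mulmxl u M v : dot (u *m M) v = (u *m M *m v^T) 0 0.
Proof. by []. Qed.

Lemma quad_sum u v M :
  (u *m M *m v^T) 0 0 = \sum_i \sum_j u 0 i * v 0 j * M i j.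
Proof.
rewrite mxE exchange_big; apply: eq_bigr => j _; rewrite !mxE mulr_suml.
by apply: eq_bigr => i _; rewrite mulrAC.
Qed.

Lemma rank1_mul u v : u *m (v^T *m v) = dot u v *: v.
Proof.
by rewrite mulmxA [u *m _]mx11_scalar mul_scalar_mx.
Qed.

Lemma trace_rank1 u v : \tr (u^T *m v) = dot u v.
Proof.
by rewrite mxtrace_mulC /mxtrace big_ord1 -/(dot v u) dotC.
Qed.

Section Frame.
Variables (I : finType) (w : I -> 'rV[R]_d).
Hypothesis w_frame : \sum_i (w i)^T *m w i = 1%:M.

Lemma frame_decomp u : u = \sum_i dot (w i) u *: w i.
Proof.
rewrite -[LHS]mulmx1 -w_frame mulmx_sumr; apply: eq_bigr => i _.
by rewrite rank1_mul dotC.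
Qed.

Lemma frame_parseval u : \sum_i dot (w i) u ^+ 2 = sqnorm u.
Proof.
rewrite /sqnorm [X in _ = dot _ X]frame_decomp dot_sumr; apply: eq_bigr => i _.
by rewrite dotZr expr2 dotC.
Qed.

Lemma frame_trace M : \tr M = \sum_i dot (w i *m M) (w i).
Proof.
rewrite -[M in LHS]mul1mx -w_frame mulmx_suml raddf_sum /=.
by apply: eq_bigr => i _; rewrite -mulmxA trace_rank1 dotC.
Qed.

(** Squared norms act as multiplicities: the frame may have more than [d] vectors, yet these weights
    sum to [d]. *)
Lemma frame_dim : \sum_i sqnorm (w i) = d%:R.
Proof.
rewrite -mxtrace1 frame_trace; apply: eq_bigr => i _.
by rewrite mulmx1.
Qed.

Variables (H : 'M[R]_d) (lam : I -> R).
Hypothesis w_eigen : forall i, w i *m H = lam i *: w i.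

Lemma frame_quad u v :
  (u *m H *m v^T) 0 0 = \sum_i lam i * (dot (w i) u * dot (w i) v).
Proof.
rewrite -dot_mulmxl {1}(frame_decomp u) mulmx_suml dot_suml.
apply: eq_bigr => i _; rewrite -scalemxAl w_eigen !dotZl; ring.
Qed.

Lemma frame_trace_eigen : \tr H = \sum_i lam i * sqnorm (w i).
Proof.
by rewrite frame_trace; apply: eq_bigr => i _; rewrite w_eigen dotZl.
Qed.

Variable c : I -> R.
Let M := \sum_i c i *: ((w i)^T *m w i).

(** In [det_risk_step], hypothesis (ii) is applied to a matrix [M] of this shape. *)
Lemma weighted_frame_quad u : dot u (u *m M) = \sum_i c i * dot (w i) u ^+ 2.
Proof.
rewrite mulmx_sumr dot_sumr; apply: eq_bigr => i _.
by rewrite -scalemxAr rank1_mul !dotZr (dotC u) expr2.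
Qed.

Lemma weighted_frame_psd : (forall i, 0 <= c i) -> psd M.
Proof.
move=> c0; split.
  rewrite /M raddf_sum; apply: eq_bigr => i _ /=.
  by rewrite linearZ /= trmx_mul trmxK.
move=> v; rewrite -dot_mulmxl dotC weighted_frame_quad sumr_ge0// => i _.
by rewrite mulr_ge0// sqr_ge0.
Qed.

Lemma weighted_frame_trace :
  \tr (M *m H) = \sum_i c i * (lam i * sqnorm (w i)).
Proof.
rewrite mulmx_suml raddf_sum; apply: eq_bigr => i _ /=.
by rewrite -scalemxAl linearZ /= -mulmxA trace_rank1 w_eigen dotZr.
Qed.

End Frame.

Lemma psd_eigenframe (H : 'M[R]_d) : psd H ->
  exists (w : 'I_d * bool -> 'rV[R]_d) (lam : 'I_d * bool -> R),
  [/\ forall i, w i *m H = lam i *: w i, \sum_i (w i)^T *m w i = 1%:M,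
      forall i, 0 <= lam i & forall i, lam i <= \tr H].
Proof.
move=> [Hsym Hpos]; have [w [lam0 [ew fw]]] := symmetric_eigenframe Hsym.
(* The eigenvalue attached to a zero vector of the frame is arbitrary. *)
pose lam i := if w i == 0 then 0 else lam0 i.
have {}ew i : w i *m H = lam i *: w i.
  by rewrite ew /lam; case: eqVneq => // ->; rewrite !scaler0.
have lam_ge0 i : 0 <= lam i.
  rewrite /lam; case: eqVneq => // w0.
  have wp : 0 < sqnorm (w i).
    by rewrite lt_neqAle sqnorm_ge0 eq_sym sqnorm_eq0 w0.
  have := Hpos (w i); rewrite -dot_mulmxl ew dotZl /lam (negbTE w0).
  by rewrite pmulr_lge0.
have tr_ge0 : 0 <= \tr H.
  rewrite (frame_trace_eigen fw ew) sumr_ge0// => i _.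
  by rewrite mulr_ge0// sqnorm_ge0.
exists w, lam; split=> // i.
have [w0|w0] := eqVneq (w i) 0; first by rewrite /lam w0 eqxx.
have wp : 0 < sqnorm (w i) by rewrite lt_neqAle sqnorm_ge0 eq_sym sqnorm_eq0 w0.
(* The frame vectors are not normalised: $\lambda_i \|w_i\|^2 = \sum_j \lambda_j \langle w_j,
   w_i\rangle^2$ is compared with $\mathrm{tr}(H) \|w_i\|^2$ by Cauchy-Schwarz. *)
rewrite -(ler_pM2r wp) -dotZl -ew dot_mulmxl (frame_quad fw ew).
rewrite (frame_trace_eigen fw ew) mulr_suml ler_sum// => j _.
by rewrite -mulrA ler_wpM2l// -expr2 cauchy_schwarz.
Qed.

End Dot.

(** * Means of real functions *)

Section IntegralMono.
Import HBNNSimple.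

(** Stated for arbitrary functions, so as to apply to [run_risk] without a study of its
    measurability in the state. The integrals of the positive and negative parts are suprema over
    the simple functions below them, hence monotone. *)
Lemma integral_mono d (T : measurableType d) (R : realType)
    (mu : {measure set T -> \bar R}) (f g : T -> \bar R) :
  (forall x, f x <= g x)%E ->
  (\int[mu]_(x in setT) f x <= \int[mu]_(x in setT) g x)%E.
Proof.
move=> fg; rewrite /integral; rewrite !patch_setT.
have nnle (u v : T -> \bar R) : (forall x, u x <= v x)%E ->
    (ereal_sup [set sintegral mu h | h in
       [set h : {nnsfun T >-> R} | forall x, ((h x)%:E <= u x)%E]] <=
     ereal_sup [set sintegral mu h | h in
       [set h : {nnsfun T >-> R} | forall x, ((h x)%:E <= v x)%E]])%E.
  move=> uv; apply: le_ereal_sup => _ [h hu <-].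
  by exists h => // x; exact: le_trans (hu x) (uv x).
apply: leeB; apply: nnle => x.
  by rewrite !funeposE ge_max !le_max fg lexx orbT.
by rewrite !funenegE ge_max !le_max leeN2 fg lexx orbT.
Qed.

End IntegralMono.

Section Mean.
Context {R : realType} {dT : measure_display} {T : measurableType dT}.
Variable P : probability T R.
Implicit Types (f g : T -> R) (m c : R).

Definition has_mean f m :=
  P.-integrable [set: T] (EFin \o f) /\ Defs.E P f = m.

Lemma has_mean_integral f m : has_mean f m ->
  (\int[P]_(z in setT) (f z)%:E = m%:E)%E.
Proof.
move=> [fi <-]; rewrite /Defs.E /Rintegral fineK//.
exact: (integrable_fin_num _ fi).
Qed.

Lemma integrable_has_mean f :
  P.-integrable [set: T] (EFin \o f) -> has_mean f (Defs.E P f).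
Proof. by []. Qed.

Lemma eq_has_mean f g m : f =1 g -> has_mean f m -> has_mean g m.
Proof. by move=> /funext ->. Qed.

Lemma has_mean_cst c : has_mean (fun=> c) c.
Proof.
split; first exact: finite_measure_integrable_cst.
by rewrite /Defs.E Rintegral_cst//= probability_setT mulr1.
Qed.

Lemma has_meanD f g m m' : has_mean f m -> has_mean g m' ->
  has_mean (fun z => f z + g z) (m + m').
Proof.
move=> [fi <-] [gi <-]; split; last by rewrite /Defs.E RintegralD.
by apply: eq_integrable (integrableD _ fi gi).
Qed.

Lemma has_meanZ f m c : has_mean f m -> has_mean (fun z => c * f z) (c * m).
Proof.
move=> [fi <-]; split; last by rewrite /Defs.E RintegralZl.
by apply: eq_integrable (integrableZl _ c fi).
Qed.

Lemma has_mean_sum (I : finType) (F : I -> T -> R) (M : I -> R) :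
  (forall i, has_mean (F i) (M i)) ->
  has_mean (fun z => \sum_i F i z) (\sum_i M i).
Proof.
move=> h; elim: (index_enum I) => [|i s IH].
  rewrite big_nil; apply: eq_has_mean (has_mean_cst 0) => z.
  by rewrite big_nil.
rewrite big_cons; apply: eq_has_mean (has_meanD (h i) IH) => z.
by rewrite big_cons.
Qed.

Lemma has_mean_le f g m m' : has_mean f m -> has_mean g m' ->
  (forall z, f z <= g z) -> m <= m'.
Proof.
by move=> [fi <-] [gi <-] fg; apply: le_Rintegral.
Qed.

Lemma has_mean_le_ereal f m c : has_mean f m ->
  (\int[P]_(z in setT) (f z)%:E <= c%:E)%E -> m <= c.
Proof. by move=> /has_mean_integral ->; rewrite lee_fin. Qed.

Lemma ge0_integrable f : measurable_fun setT f -> (forall z, 0 <= f z) ->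
  (\int[P]_(z in setT) (f z)%:E < +oo)%E ->
  P.-integrable [set: T] (EFin \o f).
Proof.
move=> mf f0 foo; apply/integrableP; split; first exact/measurable_EFinP.
by under eq_integral do rewrite /= ger0_norm//.
Qed.

Lemma integrable_dominated f g : measurable_fun setT f ->
  (forall z, `|f z| <= g z) -> P.-integrable [set: T] (EFin \o g) ->
  P.-integrable [set: T] (EFin \o f).
Proof.
move=> mf fg gi; apply: le_integrable gi => //; first exact/measurable_EFinP.
by move=> z _ /=; rewrite lee_fin; apply: le_trans (fg z) (ler_norm _).
Qed.

Lemma integrable_prod f g :
  measurable_fun setT f -> measurable_fun setT g ->
  P.-integrable [set: T] (EFin \o (fun z => f z ^+ 2)) ->
  P.-integrable [set: T] (EFin \o (fun z => g z ^+ 2)) ->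
  P.-integrable [set: T] (EFin \o (fun z => f z * g z)).
Proof.
move=> mf mg fi gi.
apply: (@integrable_dominated _ (fun z => f z ^+ 2 + g z ^+ 2)).
- exact: measurable_funM.
- move=> z; rewrite normrM -(real_normK (num_real (f z))).
  rewrite -(real_normK (num_real (g z))).
  have := sqr_ge0 (`|f z| - `|g z|); have := sqr_ge0 (`|f z| + `|g z|).
  by rewrite sqrrD sqrrB; lra.
- by have [] := has_meanD (integrable_has_mean fi) (integrable_has_mean gi).
Qed.

(** Hypotheses (i) and (ii) only bound fourth-order moments; this form keeps integrability next to
    the bound, so that bounds can be added and scaled. *)
Definition mean_le f c := exists2 m, has_mean f m & m <= c.

Lemma mean_le_bound f c : measurable_fun setT f -> (forall z, 0 <= f z) ->
  (\int[P]_(z in setT) (f z)%:E <= c%:E)%E -> mean_le f c.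
Proof.
move=> mf f0 fc.
have /integrable_has_mean h : P.-integrable [set: T] (EFin \o f).
  by apply: ge0_integrable => //; apply: le_lt_trans fc (ltry _).
by exists (Defs.E P f) => //; apply: has_mean_le_ereal h fc.
Qed.

Lemma mean_leD f g c (c' : R) : mean_le f c -> mean_le g c' ->
  mean_le (fun z => f z + g z) (c + c').
Proof.
move=> [m hm mc] [m' hm' mc'].
by exists (m + m'); [exact: has_meanD | exact: lerD].
Qed.

Lemma mean_leZ f c (k : R) : 0 <= k -> mean_le f c ->
  mean_le (fun z => k * f z) (k * c).
Proof.
by move=> k0 [m hm mc]; exists (k * m); [exact: has_meanZ|exact: ler_wpM2l].
Qed.

Lemma mean_le_sum (I : finType) (F : I -> T -> R) (C : I -> R) :
  (forall i, mean_le (F i) (C i)) ->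
  mean_le (fun z => \sum_i F i z) (\sum_i C i).
Proof.
move=> h.
have /choice [M hM] : forall i, exists m, has_mean (F i) m /\ m <= C i.
  by move=> i; have [m] := h i; exists m.
exists (\sum_i M i); first by apply: has_mean_sum => i; exact: (hM i).1.
by apply: ler_sum => i _; exact: (hM i).2.
Qed.

Lemma has_mean_mean_le f c : has_mean f c -> mean_le f c.
Proof. by exists c. Qed.

End Mean.

(** An abstract first-order optimality condition. The choice [s = m / (q + 1)] reduces the
    hypothesis to $m^2 (q + 1) \le m^2 q$. *)
Lemma linear_le_quadratic (R : realFieldType) (m q : R) :
  (forall s, s * m <= s ^+ 2 * q) -> m = 0.
Proof.
move=> h; have q0 : 0 <= q by have := h 1; have := h (-1); lra.
apply/eqP; rewrite -sqrf_eq0 eq_le sqr_ge0 andbT.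
have q1 : 0 < q + 1 by lra.
have := h (m / (q + 1)).
have -> : m / (q + 1) * m = m ^+ 2 * (q + 1) / (q + 1) ^+ 2.
  by field; rewrite gt_eqF.
rewrite expr_div_n [leRHS]mulrAC ler_pM2r ?invr_gt0 ?exprn_gt0//; lra.
Qed.

(** * Weighted sums with coefficients in a list *)

Section WeightedSum.
Context {R : realFieldType}.
Implicit Types (f g : nat -> R) (c : seq R).

(** The coefficients form a list because a step of the dynamics shifts them and prepends a new
    one. *)
Definition wsum f c : R := \sum_(k < size c) c`_k * f k.

Lemma wsum_cons f x c : wsum f (x :: c) = x * f 0%N + wsum (fun k => f k.+1) c.
Proof. by rewrite /wsum big_ord_recl. Qed.

Lemma eq_wsum f g c : f =1 g -> wsum f c = wsum g c.
Proof. by move=> fg; apply: eq_bigr => k _; rewrite fg. Qed.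

Lemma wsumD f g c : wsum (fun k => f k + g k) c = wsum f c + wsum g c.
Proof. by rewrite -big_split; apply: eq_bigr => k _; rewrite mulrDr. Qed.

Lemma wsumZ x f c : wsum (fun k => x * f k) c = x * wsum f c.
Proof. by rewrite mulr_sumr; apply: eq_bigr => k _; rewrite mulrCA. Qed.

Lemma ler_wsum f g c : (forall k, 0 <= c`_k) ->
  (forall k, (k < size c)%N -> f k <= g k) -> wsum f c <= wsum g c.
Proof.
by move=> c0 fg; apply: ler_sum => k _; apply: ler_wpM2l => //; exact: fg.
Qed.

End WeightedSum.

(** * Moments of the samples and value functions *)

Section LeastSquares.
Context {R : realType} {d : nat} {dT : measure_display} {T : measurableType dT}.
Variables (P : probability T R) (A : T -> 'rV[R]_d) (B : T -> R).
Hypotheses (hA : forall i : 'I_d, measurable_fun setT (fun z => A z 0 i))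
  (hB : measurable_fun setT B)
  (ha2 : (\int[P]_(z in setT) (sqnorm (A z))%:E < +oo)%E)
  (hb2 : (\int[P]_(z in setT) (B z ^+ 2)%:E < +oo)%E).
Implicit Types u v : 'rV[R]_d.

Let H := Hmat P A.

Lemma measurable_dot u : measurable_fun setT (fun z => dot u (A z)).
Proof.
under eq_fun do rewrite dotE; apply: measurable_sum => i.
exact: measurable_funM.
Qed.

Lemma measurable_sqnorm : measurable_fun setT (fun z => sqnorm (A z)).
Proof.
rewrite /sqnorm; under eq_fun do rewrite dotE; apply: measurable_sum => i.
exact: measurable_funM.
Qed.

Lemma integrable_dot2 u :
  P.-integrable [set: T] (EFin \o (fun z => dot u (A z) ^+ 2)).
Proof.
apply: (@integrable_dominated _ _ _ _ _ (fun z => sqnorm u * sqnorm (A z))).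
- exact: measurable_funX (measurable_dot u).
- by move=> z; rewrite ger0_norm ?sqr_ge0// cauchy_schwarz.
- have := ge0_integrable measurable_sqnorm (fun z => sqnorm_ge0 (A z)) ha2.
  by move=> /integrable_has_mean /(has_meanZ (sqnorm u)) [].
Qed.

Lemma has_mean_entry i j : has_mean P (fun z => A z 0 i * A z 0 j) (H i j).
Proof.
rewrite mxE; apply: integrable_has_mean.
have := @integrable_prod _ _ _ P (fun z => dot (delta_mx 0 i) (A z))
  (fun z => dot (delta_mx 0 j) (A z)) (measurable_dot _) (measurable_dot _)
  (integrable_dot2 _) (integrable_dot2 _).
congr (integrable _ _ (EFin \o _)); apply/funext => z.
have e k : dot (delta_mx 0 k) (A z) = A z 0 k.
  rewrite dotE (bigD1 k)//= big1 ?addr0 => [|l lk]; rewrite mxE eqxx /=.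
    by rewrite eqxx mul1r.
  by rewrite (negbTE lk) mul0r.
by rewrite !e.
Qed.

Lemma has_mean_dot2 u v : has_mean P (fun z => dot u (A z) * dot v (A z))
  ((u *m H *m v^T) 0 0).
Proof.
rewrite quad_sum.
apply: (@eq_has_mean _ _ _ _
  (fun z => \sum_i \sum_j u 0 i * v 0 j * (A z 0 i * A z 0 j))).
  move=> z; rewrite !dotE mulr_suml; apply: eq_bigr => i _.
  by rewrite mulr_sumr; apply: eq_bigr => j _; rewrite mulrACA.
apply: has_mean_sum => i; apply: has_mean_sum => j.
exact/has_meanZ/has_mean_entry.
Qed.

Lemma Hmat_psd : psd H.
Proof.
split.
  by apply/matrixP => i j; rewrite !mxE; congr (Defs.E _ _);
     apply/funext => z; rewrite mulrC.
move=> v; apply: has_mean_le (has_mean_cst P 0) (has_mean_dot2 v v) _ => z.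
by rewrite -expr2 sqr_ge0.
Qed.

Variable xstar : 'rV[R]_d.
Hypothesis hxstar : forall x, (risk P A B xstar <= risk P A B x)%E.

Definition residual z : R := B z - dot xstar (A z).
Let e := residual.

Lemma measurable_residual : measurable_fun setT e.
Proof. exact: measurable_funB hB (measurable_dot xstar). Qed.

Lemma integrable_residual2 :
  P.-integrable [set: T] (EFin \o (fun z => e z ^+ 2)).
Proof.
apply: (@integrable_dominated _ _ _ _ _
  (fun z => 2 * (B z ^+ 2) + 2 * (dot xstar (A z)) ^+ 2)).
- exact: measurable_funX measurable_residual.
- move=> z; rewrite ger0_norm ?sqr_ge0// /e /residual.
  have := sqr_ge0 (B z + dot xstar (A z)).
  by rewrite sqrrD sqrrB; lra.
- have mb : measurable_fun setT (fun z => B z ^+ 2) by exact: measurable_funX.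
  have := ge0_integrable mb (fun z => sqr_ge0 (B z)) hb2.
  move=> /integrable_has_mean /(has_meanZ 2) h1.
  have /integrable_has_mean /(has_meanZ 2) h2 := integrable_dot2 xstar.
  by case: (has_meanD h1 h2).
Qed.

Definition min_risk : R := 2^-1 * Defs.E P (fun z => e z ^+ 2).

Lemma risk_expand u : risk P A B (xstar + u) =
  (2^-1 * (u *m H *m u^T) 0 0 - Defs.E P (fun z => e z * dot u (A z))
     + min_risk)%:E.
Proof.
apply: has_mean_integral.
have h1 := has_meanZ 2^-1 (has_mean_dot2 u u).
have /integrable_has_mean /(has_meanZ (-1)) h2 :=
  integrable_prod measurable_residual (measurable_dot u) integrable_residual2
    (integrable_dot2 u).
have /integrable_has_mean /(has_meanZ 2^-1) h3 := integrable_residual2.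
have := has_meanD (has_meanD h1 h2) h3; rewrite mulN1r.
apply: eq_has_mean => z; rewrite dotDl /e /residual.
by field.
Qed.

(** The normal equations: minimality of the risk along [xstar + s *: u] bounds a linear function of
    [s] by a quadratic one. *)
Lemma has_mean_residual u : has_mean P (fun z => e z * dot u (A z)) 0.
Proof.
have /integrable_has_mean h :=
  integrable_prod measurable_residual (measurable_dot u) integrable_residual2
    (integrable_dot2 u).
suff e0 : Defs.E P (fun z => e z * dot u (A z)) = 0 by rewrite e0 in h.
apply: (@linear_le_quadratic _ _ (2^-1 * (u *m H *m u^T) 0 0)) => s.
have := hxstar (xstar + s *: u); rewrite -{1}(addr0 xstar) !risk_expand lee_fin.
have -> : Defs.E P (fun z => e z * dot 0 (A z)) = 0.
  have [_ <-] := has_mean_cst P 0; congr (Defs.E _ _); apply/funext => z.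
  by rewrite dotC dot0r mulr0.
have -> : Defs.E P (fun z => e z * dot (s *: u) (A z))
  = s * Defs.E P (fun z => e z * dot u (A z)).
  have [_ <-] := has_meanZ s h; congr (Defs.E _ _); apply/funext => z.
  by rewrite dotZl mulrCA.
rewrite -!dot_mulmxl mul0mx dot0r -scalemxAl dotZl dotZr !dot_mulmxl; lra.
Qed.

Lemma risk_excess u : risk P A B (xstar + u) =
  (2^-1 * (u *m H *m u^T) 0 0 + min_risk)%:E.
Proof. by rewrite risk_expand (has_mean_residual u).2 subr0. Qed.

(** * Consequences of the two fourth-moment hypotheses *)

Variables sigma kappa : R.
Hypothesis hsigma : forall v : 'rV[R]_d,
  (\int[P]_(z in setT) ((B z - dot xstar (A z)) ^+ 2 * dot v (A z) ^+ 2)%:E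
    <= (sigma ^+ 2 * (v *m H *m v^T) 0 0)%:E)%E.
Hypothesis hkappa : forall M : 'M[R]_d, psd M -> forall v : 'rV[R]_d,
  (\int[P]_(z in setT) (dot (A z) (A z *m M) * dot v (A z) ^+ 2)%:E
    <= (kappa * \tr (M *m H) * (v *m H *m v^T) 0 0)%:E)%E.

Lemma mean_residual2_dot2 v : mean_le P (fun z => e z ^+ 2 * dot v (A z) ^+ 2)
  (sigma ^+ 2 * (v *m H *m v^T) 0 0).
Proof.
apply: mean_le_bound (hsigma v) => [|z].
  apply: measurable_funM; apply: measurable_funX.
    exact: measurable_residual.
  exact: measurable_dot.
by rewrite mulr_ge0 ?sqr_ge0.
Qed.

Lemma measurable_quad M : measurable_fun setT (fun z => dot (A z) (A z *m M)).
Proof.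
under eq_fun do rewrite dotE; apply: measurable_sum => i.
apply: measurable_funM => //.
under eq_fun do rewrite mxE; apply: measurable_sum => j.
by apply: measurable_funM => //; exact: measurable_cst.
Qed.

Lemma mean_quad_dot2 M v : psd M ->
  mean_le P (fun z => dot (A z) (A z *m M) * dot v (A z) ^+ 2)
    (kappa * \tr (M *m H) * (v *m H *m v^T) 0 0).
Proof.
move=> hM; apply: mean_le_bound (hkappa hM v) => [|z].
  apply: measurable_funM; first exact: measurable_quad.
  exact/measurable_funX/measurable_dot.
by rewrite mulr_ge0 ?sqr_ge0// dotC dot_mulmxl; exact: hM.2.
Qed.

Lemma psd_rank1 u : psd (u^T *m u).
Proof.
split; first by rewrite trmx_mul trmxK.
by move=> v; rewrite -dot_mulmxl rank1_mul dotZl dotC -expr2 sqr_ge0.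
Qed.

(** The integrand is the product of [e z * dot u (A z)], square integrable by (i), and
    [dot u (A z) * dot v (A z)], square integrable by (ii) for the matrix [u^T *m u]. *)
Lemma integrable_residual_dot3 u v : P.-integrable [set: T]
  (EFin \o (fun z => e z * dot u (A z) ^+ 2 * dot v (A z))).
Proof.
have [_ [i1 _] _] := mean_residual2_dot2 u.
have [_ [i2 _] _] := mean_quad_dot2 v (psd_rank1 u).
have := @integrable_prod _ _ _ P (fun z => e z * dot u (A z))
  (fun z => dot u (A z) * dot v (A z)).
move=> h.
have -> : (fun z => e z * dot u (A z) ^+ 2 * dot v (A z)) =
   (fun z => e z * dot u (A z) * (dot u (A z) * dot v (A z))).
  by apply/funext => z; ring.
apply: h.
- exact: measurable_funM measurable_residual (measurable_dot u).
- exact: measurable_funM (measurable_dot u) (measurable_dot v).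
- by congr (integrable _ _ (EFin \o _)): i1; apply/funext => z; ring.
- congr (integrable _ _ (EFin \o _)): i2; apply/funext => z.
  by rewrite rank1_mul dotZr (dotC (A z)); ring.
Qed.

(** * Eigenframe of [H] and spectral form of the step-size conditions *)

Variables (w : 'I_d * bool -> 'rV[R]_d) (lam : 'I_d * bool -> R).
Hypotheses (w_eigen : forall i, w i *m H = lam i *: w i)
  (w_frame : \sum_i (w i)^T *m w i = 1%:M)
  (lam_ge0 : forall i, 0 <= lam i) (lam_le : forall i, lam i <= \tr H).
Hypothesis hH : H \in unitmx.

Lemma trace_gt0 : (0 < d)%N -> 0 < \tr H.
Proof.
move=> d0; have i0 : 'I_d * bool by exact: (Ordinal d0, true).
have tr_ge0 : 0 <= \tr H by exact: le_trans (lam_ge0 i0) (lam_le i0).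
rewrite lt_neqAle tr_ge0 andbT eq_sym; apply/eqP => tr0.
have H0 : H = 0.
  rewrite -[H]mul1mx -w_frame mulmx_suml big1// => i _.
  rewrite -mulmxA w_eigen (_ : lam i = 0) ?scale0r ?mulmx0//.
  by apply/eqP; rewrite eq_le lam_ge0 -tr0 lam_le.
have := congr1 mxtrace (mulmxV hH); rewrite {1}H0 mul0mx mxtrace0 mxtrace1.
by move/esym/eqP; rewrite pnatr_eq0 -leqn0 leqNgt d0.
Qed.

(* (E|a|^2)^2 <= E|a|^4 <= kappa (E|a|^2)^2, by [hkappa] with M = 1. *)
Lemma kappa_ge1 : (0 < d)%N -> 1 <= kappa.
Proof.
move=> /trace_gt0 tr_gt0.
have psd1 : psd (1%:M : 'M[R]_d).
  split; first exact: trmx1.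
  by move=> v; rewrite -dot_mulmxl mulmx1 sqnorm_ge0.
have [m hm mle] := mean_le_sum (fun i => mean_quad_dot2 (w i) psd1).
have {}mle : m <= kappa * \tr H ^+ 2.
  apply: le_trans mle _; rewrite le_eqVlt; apply/orP; left; apply/eqP.
  rewrite -mulr_sumr mul1mx expr2 mulrA; congr (_ * _).
  rewrite (frame_trace_eigen w_frame w_eigen); apply: eq_bigr => i _.
  by rewrite -dot_mulmxl w_eigen dotZl.
have hs : has_mean P (fun z => sqnorm (A z)) (\tr H).
  apply: (@eq_has_mean _ _ _ _ (fun z => \sum_i A z 0 i * A z 0 i)).
    by move=> z; rewrite /sqnorm dotE.
  by apply: has_mean_sum => i; exact: has_mean_entry.
have {}hm : has_mean P (fun z => sqnorm (A z) ^+ 2) m.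
  apply: eq_has_mean hm => z; rewrite -mulr_sumr mulmx1.
  by rewrite (frame_parseval w_frame) -expr2.
(* Jensen's inequality for the square, through its tangent at [\tr H]. *)
have := has_mean_le (has_meanZ (2 * \tr H) hs)
  (has_meanD hm (has_mean_cst P (\tr H ^+ 2))).
have tr2 : 0 < \tr H ^+ 2 by rewrite exprn_gt0.
suff sq z : 2 * \tr H * sqnorm (A z) <= sqnorm (A z) ^+ 2 + \tr H ^+ 2.
  by move=> /(_ sq) h; rewrite -(ler_pM2r tr2); lra.
by have := sqr_ge0 (sqnorm (A z) - \tr H); rewrite sqrrB; lra.
Qed.

Variables alpha beta : R.
Hypotheses (halpha : 0 < alpha) (hbeta : 0 < beta)
  (hstep1 : kappa * (alpha + 2 * beta) * \tr H <= 1)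
  (hstep2 : alpha * (2 * kappa * d%:R) <= beta).

Lemma index_dim_gt0 (i : 'I_d * bool) : (0 < d)%N.
Proof. by case: i => -[k kd] _; exact: leq_ltn_trans kd. Qed.

(** The index [i] witnesses [0 < d], which [kappa_ge1] requires; then [1 <= kappa * d%:R] and
    [hstep2] applies. *)
Lemma alpha_small (i : 'I_d * bool) : 2 * alpha <= beta.
Proof.
have d0 := index_dim_gt0 i; have k1 := kappa_ge1 d0.
have kd : 1 <= kappa * d%:R.
  by rewrite mulr_ege1// ler1n.
apply: le_trans hstep2.
rewrite (_ : alpha * (2 * kappa * d%:R) = 2 * (alpha * (kappa * d%:R)));
  last by ring.
by rewrite ler_pM2l// ler_peMr// ltW.
Qed.

Lemma lam_small i : (alpha + 2 * beta) * lam i <= 1.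
Proof.
have d0 := index_dim_gt0 i; have k1 := kappa_ge1 d0.
have ab : 0 < alpha + 2 * beta by rewrite addr_gt0// mulr_gt0.
apply: le_trans hstep1; rewrite -mulrA.
have h : 0 <= (alpha + 2 * beta) * \tr H.
  by apply: mulr_ge0; apply: ltW => //; exact: trace_gt0.
have h1 : (alpha + 2 * beta) * lam i <= (alpha + 2 * beta) * \tr H.
  by rewrite ler_wpM2l// ltW.
by have := ler_wpM2r h k1; lra.
Qed.

(** * Noise kernel and risk of the averaged dynamics *)

Definition noise_gain k i : R :=
  lam i * resp alpha beta (lam i) k (alpha + beta) alpha ^+ 2.

(** This is [\tr (M *m H)] for [M = \sum_i noise_gain k i *: ((w i)^T *m w i)], the trace that (ii)
    produces. *)
Definition kernel k : R := \sum_i noise_gain k i * (lam i * sqnorm (w i)).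

Definition det_risk k (X Z : 'rV[R]_d) : R :=
  \sum_i lam i * resp alpha beta (lam i) k (dot (w i) X) (dot (w i) Z) ^+ 2.

Lemma noise_gain_ge0 k i : 0 <= noise_gain k i.
Proof. by rewrite mulr_ge0 ?sqr_ge0. Qed.

Lemma kernel_ge0 k : 0 <= kernel k.
Proof.
rewrite sumr_ge0// => i _; apply: mulr_ge0 (noise_gain_ge0 _ _) _.
exact: mulr_ge0 (sqnorm_ge0 _).
Qed.

(** Stated for the product because the sign of [kappa] is known only for [0 < d]; the kernel is an
    empty sum when [d = 0]. *)
Lemma kappa_kernel_ge0 k : 0 <= kappa * kernel k.
Proof.
rewrite mulr_sumr sumr_ge0// => i _.
have k1 := kappa_ge1 (index_dim_gt0 i).
apply: mulr_ge0; first lra.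
apply: mulr_ge0 (noise_gain_ge0 _ _) _; exact: mulr_ge0 (sqnorm_ge0 _).
Qed.

Lemma det_risk_ge0 k X Z : 0 <= det_risk k X Z.
Proof. by rewrite sumr_ge0// => i _; rewrite mulr_ge0 ?sqr_ge0. Qed.

Definition noise_level : R :=
  (alpha + 2 * beta) * \tr H + 2 * alpha * d%:R / beta.

Lemma noise_levelE : noise_level =
  \sum_i sqnorm (w i) * (2 * alpha / beta + (alpha + 2 * beta) * lam i).
Proof.
under eq_bigr do rewrite mulrDr.
rewrite big_split /= -mulr_suml (frame_dim w_frame) /noise_level.
rewrite (frame_trace_eigen w_frame w_eigen) mulr_sumr [LHS]addrC; congr (_ + _).
  by ring.
by apply: eq_bigr => i _; ring.
Qed.

Definition cumul_kernel k : R := \sum_(j < k) kernel j.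

Lemma cumul_kernelE k : cumul_kernel k =
  \sum_i sqnorm (w i) * (lam i ^+ 2 *
     \sum_(j < k) resp alpha beta (lam i) j (alpha + beta) alpha ^+ 2).
Proof.
rewrite /cumul_kernel exchange_big; apply: eq_bigr => i _ /=.
rewrite !mulr_sumr; apply: eq_bigr => j _; rewrite /noise_gain; ring.
Qed.

Lemma cumul_kernel_le k : cumul_kernel k <= noise_level / 3.
Proof.
rewrite cumul_kernelE noise_levelE mulr_suml ler_sum// => i _.
rewrite -mulrA ler_wpM2l ?sqnorm_ge0//.
by apply: resp_noise_sum => //; [exact: alpha_small i | exact: lam_small].
Qed.

Lemma noise_level_ge0 : 0 <= noise_level.
Proof.
rewrite noise_levelE sumr_ge0// => i _; rewrite mulr_ge0 ?sqnorm_ge0//.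
by rewrite addr_ge0 ?mulr_ge0 ?addr_ge0 ?invr_ge0// ?mulr_ge0// ltW.
Qed.

(** Each of [hstep1] and [hstep2] contributes at most 1 to [kappa * noise_level], and
    [cumul_kernel_le] divides by 3. *)
Lemma kappa_cumul_kernel_le k : kappa * cumul_kernel k <= 2 / 3.
Proof.
have [d0|d0] := posnP d.
  rewrite /cumul_kernel big1 ?mulr0// => j _.
  rewrite /kernel big1// => i _.
  by have := index_dim_gt0 i; rewrite {1}d0.
have k1 := kappa_ge1 d0.
have k0 : 0 <= kappa by lra.
have h := ler_wpM2l k0 (cumul_kernel_le k); apply: le_trans h _.
suff : kappa * noise_level <= 2 by lra.
have -> : kappa * noise_level = kappa * (alpha + 2 * beta) * \tr H
    + alpha * (2 * kappa * d%:R) / beta by rewrite /noise_level; ring.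
have : alpha * (2 * kappa * d%:R) / beta <= 1 by rewrite ler_pdivrMr// mul1r.
by move: hstep1; lra.
Qed.

(** * Effect of one random step, and renewal weights *)

Lemma has_mean_residual_cubic (c : 'I_d * bool -> R) : exists l : 'rV[R]_d,
  forall X : 'rV[R]_d, has_mean P
    (fun z => \sum_i c i * (e z * dot (w i) (A z) ^+ 2 * dot X (A z))) (dot l X).
Proof.
(* Only the linearity in [X] of this cross moment of the two noises is recorded; its size is not
   estimated. *)
pose f j z := \sum_i c i * (e z * dot (w i) (A z) ^+ 2 * dot 'e_j (A z)).
have hf j : has_mean P (f j) (Defs.E P (f j)).
  have h i := has_meanZ (c i)
    (integrable_has_mean (integrable_residual_dot3 (w i) 'e_j)).
  by have [hi _] := has_mean_sum h; exact: integrable_has_mean.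
exists (\row_j Defs.E P (f j)) => X.
have := has_mean_sum (fun j => has_meanZ (X 0 j) (hf j)).
rewrite dotE (eq_bigr (fun j => (\row_j Defs.E P (f j)) 0 j * X 0 j)); last first.
  by move=> j _; rewrite mxE mulrC.
apply: eq_has_mean => z; rewrite /f.
under eq_bigr do rewrite mulr_sumr.
rewrite exchange_big; apply: eq_bigr => i _ /=.
rewrite {2}(row_sum_delta X) dot_suml !mulr_sumr; apply: eq_bigr => j _.
by rewrite dotZl; ring.
Qed.

(** For [tau = t + 1] this is $(t+1)(\langle a_t, x_t\rangle - b_t)$ in the rescaled variables. *)
Definition grad_coef (tau : R) (X : 'rV[R]_d) z : R := dot X (A z) - tau * e z.

Definition next_X (tau : R) (X Z : 'rV[R]_d) z : 'rV[R]_d :=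
  X + Z - ((alpha + beta) * grad_coef tau X z) *: A z.

Definition next_Z (tau : R) (X Z : 'rV[R]_d) z : 'rV[R]_d :=
  Z - (alpha * grad_coef tau X z) *: A z.

Lemma det_risk_next k tau X Z z :
  det_risk k (next_X tau X Z z) (next_Z tau X Z z) =
  \sum_i lam i * (resp alpha beta (lam i) k (dot (w i) X + dot (w i) Z)
      (dot (w i) Z)
    - grad_coef tau X z * dot (w i) (A z)
      * resp alpha beta (lam i) k (alpha + beta) alpha) ^+ 2.
Proof.
apply: eq_bigr => i _; congr (_ * _ ^+ 2).
rewrite /next_X /next_Z !dotDr !dotNr !dotZr -[in RHS]mulNr -resp_comb.
by congr resp; ring.
Qed.

(** Expand the square of response minus kick. The mean of the kick rebuilds [det_risk k.+1], the
    squared multiplicative noise is bounded by (ii), the squared additive noise by (i), and the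
    product of the two noises is the linear term. The vector [l] is chosen before [tau], [X] and
    [Z]. *)
Lemma det_risk_step k : exists l : 'rV[R]_d, forall tau X Z,
  mean_le P (fun z => det_risk k (next_X tau X Z z) (next_Z tau X Z z))
    (det_risk k.+1 X Z + kappa * kernel k * (X *m H *m X^T) 0 0
       + tau * dot l X + tau ^+ 2 * (sigma ^+ 2 * kernel k)).
Proof.
have [l hl] := has_mean_residual_cubic (fun i => - 2 * noise_gain k i).
exists l => tau X Z.
pose c i := resp alpha beta (lam i) k (dot (w i) X + dot (w i) Z) (dot (w i) Z).
pose rho i := resp alpha beta (lam i) k (alpha + beta) alpha.
pose M := \sum_i noise_gain k i *: ((w i)^T *m w i).
have h1 := has_mean_mean_le (has_mean_cst P (\sum_i lam i * c i ^+ 2)).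
have h2 := has_mean_mean_le (has_mean_sum (fun i =>
  has_meanZ (- 2 * lam i * c i * rho i) (has_mean_dot2 (w i) X))).
have h3 := has_mean_mean_le (has_mean_sum (fun i =>
  has_meanZ (2 * lam i * c i * rho i * tau) (has_mean_residual (w i)))).
have h4 := mean_quad_dot2 X (weighted_frame_psd w (noise_gain_ge0 k)).
have h5 := has_mean_mean_le (has_meanZ tau (hl X)).
have h6 := mean_leZ (sqr_ge0 tau) (mean_le_sum (fun i =>
  mean_leZ (noise_gain_ge0 k i) (mean_residual2_dot2 (w i)))).
have := mean_leD (mean_leD (mean_leD (mean_leD (mean_leD h1 h2) h3) h4) h5) h6.
move=> [m hm mle]; exists m.
  apply: eq_has_mean hm => z; rewrite det_risk_next.
  rewrite weighted_frame_quad !mulr_suml !mulr_sumr -!big_split /=.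
  apply: eq_bigr => i _; rewrite -/(c i) -/(rho i) /noise_gain -/(rho i).
  by rewrite /grad_coef; ring.
apply: le_trans mle _.
rewrite (weighted_frame_trace w_eigen) -/(kernel k).
have -> : \sum_i noise_gain k i * (sigma ^+ 2 * (w i *m H *m (w i)^T) 0 0)
    = sigma ^+ 2 * kernel k.
  rewrite mulr_sumr; apply: eq_bigr => i _.
  by rewrite -dot_mulmxl w_eigen dotZl mulrCA.
rewrite lerD2r lerD2r lerD2r.
rewrite -!big_split /=; apply: ler_sum => i _.
rewrite -dot_mulmxl w_eigen dotZl mulr0 addr0.
have -> : resp alpha beta (lam i) k.+1 (dot (w i) X) (dot (w i) Z)
    = c i - lam i * dot (w i) X * rho i.
  by rewrite /c /rho -[in RHS]mulNr -resp_comb /=; congr resp; ring.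
(* Adding the nonnegative squared mean of the kick completes the square of the averaged response. *)
have := mulr_ge0 (lam_ge0 i) (sqr_ge0 (lam i * dot (w i) X * rho i)).
by rewrite sqrrB; lra.
Qed.

(* Coefficients of the [n]-step value function over the deterministic risks:
   the newest entry collects the multiplicative noise injected at this step. *)
Definition weights n : seq R :=
  iter n (fun c => (kappa * wsum kernel c) :: c) [:: 1].

Lemma weights_ge0 n k : 0 <= (weights n)`_k.
Proof.
elim: n k => [|n IH] [|k] //=.
- by rewrite nth_nil.
- rewrite mulr_sumr sumr_ge0// => j _; rewrite mulrCA.
  exact: mulr_ge0 (IH _) (kappa_kernel_ge0 _).
Qed.

Lemma size_weights n : size (weights n) = n.+1.
Proof. by elim: n => //= n ->. Qed.

Lemma cumul_kernel0 : cumul_kernel 0 = 0.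
Proof. by rewrite /cumul_kernel big_ord0. Qed.

Lemma cumul_kernelS k : cumul_kernel k.+1 = cumul_kernel k + kernel k.
Proof. by rewrite /cumul_kernel big_ord_recr. Qed.

(* Renewal identity: every unit of weight but the first was produced by
   another one. *)
Lemma weights_total n : wsum (fun=> 1) (weights n) =
  1 + kappa * wsum cumul_kernel (weights n).
Proof.
elim: n => [|n IH].
  by rewrite /wsum !big_ord1 cumul_kernel0 !mulr0 addr0 mulr1.
rewrite [weights n.+1]/= !wsum_cons (eq_wsum _ cumul_kernelS) wsumD IH.
by rewrite cumul_kernel0; ring.
Qed.

(** By the renewal identity the total weight $S$ satisfies $S \le 1 + \frac{2}{3} S$. *)
Lemma weights_total_le n : wsum (fun=> 1) (weights n) <= 3.
Proof.
have := weights_total n.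
have : wsum (fun k => kappa * cumul_kernel k) (weights n)
    <= wsum (fun k => 2 / 3 * 1) (weights n).
  apply: ler_wsum => [k|k _]; first exact: weights_ge0.
  by rewrite mulr1; exact: kappa_cumul_kernel_le.
by rewrite !wsumZ; lra.
Qed.

Lemma weights_cumul_le n : wsum cumul_kernel (weights n) <= noise_level.
Proof.
have h : wsum cumul_kernel (weights n)
    <= wsum (fun=> noise_level / 3 * 1) (weights n).
  apply: ler_wsum => [k|k _]; first exact: weights_ge0.
  by rewrite mulr1; exact: cumul_kernel_le.
apply: le_trans h _; rewrite wsumZ.
have n0 : 0 <= noise_level / 3 by rewrite divr_ge0// noise_level_ge0.
by have := ler_wpM2l n0 (weights_total_le n); lra.
Qed.

(** * Value functions *)

Definition value n (X Z : 'rV[R]_d) : R :=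
  wsum (fun k => det_risk k X Z) (weights n).

Lemma det_risk0 X Z : det_risk 0 X Z = (X *m H *m X^T) 0 0.
Proof.
by rewrite (frame_quad w_frame w_eigen); apply: eq_bigr => i _; rewrite expr2.
Qed.

(** Summing [det_risk_step] with the weights, the terms in [kappa * kernel k] collect into one
    multiple of [det_risk 0 X Z]: the coefficient that [weights n.+1] prepends. *)
Lemma value_step n : exists l : 'rV[R]_d, forall tau X Z,
  mean_le P (fun z => value n (next_X tau X Z z) (next_Z tau X Z z))
    (value n.+1 X Z + tau * dot l X
       + tau ^+ 2 * (sigma ^+ 2 * wsum kernel (weights n))).
Proof.
have [L hL] := choice det_risk_step.
exists (\sum_(k < size (weights n)) (weights n)`_k *: L k) => tau X Z.
have [m hm mle] := mean_le_sum (fun k : 'I_(size (weights n)) =>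
  mean_leZ (weights_ge0 n k) (hL k tau X Z)).
exists m => //; apply: le_trans mle _.
rewrite dot_suml /value [weights n.+1]/= wsum_cons det_risk0.
rewrite le_eqVlt; apply/orP; left; apply/eqP.
under [X in tau * X]eq_bigr do rewrite dotZl.
rewrite -/(wsum (fun k => dot (L k) X) (weights n)).
rewrite -[LHS]/(wsum (fun k => det_risk k.+1 X Z
  + kappa * kernel k * (X *m H *m X^T) 0 0
  + tau * dot (L k) X + tau ^+ 2 * (sigma ^+ 2 * kernel k)) (weights n)).
rewrite !wsumD !wsumZ.
have -> : wsum (fun k => kappa * kernel k * (X *m H *m X^T) 0 0) (weights n)
    = kappa * (X *m H *m X^T) 0 0 * wsum kernel (weights n).
  by rewrite -wsumZ; apply: eq_wsum => k; ring.
by ring.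
Qed.

(** * Expected risk of a run, backwards in time *)

Lemma mean_next_X l tau X Z : has_mean P
  (fun z => dot l (next_X tau X Z z))
  (dot l X + dot l Z - (alpha + beta) * dot (l *m H) X).
Proof.
have h1 := has_meanZ (- (alpha + beta)) (has_mean_dot2 l X).
have h2 := has_meanZ ((alpha + beta) * tau) (has_mean_residual l).
have := has_meanD (has_meanD (has_mean_cst P (dot l X + dot l Z)) h1) h2.
rewrite mulr0 addr0 mulNr; apply: eq_has_mean => z.
by rewrite /next_X /grad_coef !(dotDr, dotNr, dotZr); ring.
Qed.

Lemma mean_next_Z l tau X Z : has_mean P
  (fun z => dot l (next_Z tau X Z z)) (dot l Z - alpha * dot (l *m H) X).
Proof.
have h1 := has_meanZ (- alpha) (has_mean_dot2 l X).
have h2 := has_meanZ (alpha * tau) (has_mean_residual l).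
have := has_meanD (has_meanD (has_mean_cst P (dot l Z)) h1) h2.
rewrite mulr0 addr0 mulNr; apply: eq_has_mean => z.
by rewrite /next_Z /grad_coef !(dotDr, dotNr, dotZr); ring.
Qed.

(** Here [n] counts the steps left and [t] is the time at which the run starts from the rescaled
    state. *)
Definition run_risk n t (X Z : 'rV[R]_d) : \bar R :=
  Eiter P n (fun s => risk P A B (acsgd_run alpha beta t
    (xstar + t.+1%:R^-1 *: X) (xstar + Z) [seq (A z, B z) | z <- s])).

Lemma run_riskS n t X Z : run_risk n.+1 t X Z =
  (\int[P]_(z in setT) run_risk n t.+1
     (next_X t.+1%:R X Z z) (next_Z t.+1%:R X Z z))%E.
Proof.
apply: eq_integral => z _; congr (Eiter _ _ _); apply/funext => s /=.
have t1 : t.+1%:R != 0 :> R by rewrite pnatr_eq0.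
have gE : t.+1%:R * (dot (A z) (xstar + t.+1%:R^-1 *: X) - B z)
    = grad_coef t.+1%:R X z.
  rewrite /grad_coef /e /residual dotDr dotZr (dotC X) (dotC xstar) mulrBr.
  by rewrite mulrDr mulVKf//; ring.
have run_congr x x' y y' r : x = x' -> y = y' ->
    acsgd_run alpha beta t.+1 x y r = acsgd_run alpha beta t.+1 x' y' r.
  by move=> -> ->.
apply: (congr1 (risk P A B)); apply: run_congr; last first.
  by rewrite /next_Z -gE; apply/rowP => i; rewrite !mxE; ring.
rewrite /next_X -gE; apply/rowP => i; rewrite !mxE; field.
by rewrite !gt_eqF ?ltr_wpDr.
Qed.

(** This lower bound is what controls the unspecified linear terms of [run_risk_le], in
    [run_risk_start]. *)
Lemma run_risk_ge n t X Z : (min_risk%:E <= run_risk n t X Z)%E.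
Proof.
elim: n t X Z => [|n IH] t X Z.
  rewrite /run_risk /= risk_excess lee_fin lerDr mulr_ge0 ?invr_ge0//.
  exact: Hmat_psd.2.
rewrite run_riskS -(has_mean_integral (has_mean_cst P min_risk)).
by apply: integral_mono => z; exact: IH.
Qed.

(** By induction on the steps left, integrating over the first sample the bound that starts at
    [t.+1]. The additive noises at times [t] to [t + n - 1] all have size at most [t + n], and the
    successive [wsum kernel] terms add up to [wsum cumul_kernel]. *)
Lemma run_risk_le n t : exists l l' : 'rV[R]_d, forall X Z,
  (run_risk n t X Z <= (min_risk + (2 * (t + n).+1%:R ^+ 2)^-1 *
    (value n X Z + (dot l X + dot l' Z)
     + sigma ^+ 2 * (t + n)%:R ^+ 2 * wsum cumul_kernel (weights n)))%:E)%E.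
Proof.
elim: n t => [|n IH] t.
  exists 0, 0 => X Z; rewrite /run_risk /= risk_excess lee_fin.
  rewrite addn0 !(dotC 0) !dot0r addrC lerD2l.
  rewrite /value /wsum !big_ord1 /= !mul1r det_risk0 cumul_kernel0.
  rewrite -!dot_mulmxl -scalemxAl dotZl dotZr.
  rewrite le_eqVlt; apply/orP; left; apply/eqP; field.
  by rewrite gt_eqF ?ltr_wpDr.
have [l [l' hl]] := IH t.+1; have [lv hv] := value_step n.
(* The old linear terms pulled back through the averaged step, plus the new cross term. *)
exists (t.+1%:R *: lv + l - (alpha + beta) *: (l *m H) - alpha *: (l' *m H)),
  (l + l') => X Z.
rewrite run_riskS addnS.
set gamma := (2 * _)^-1; pose K := sigma ^+ 2 * (t + n).+1%:R ^+ 2.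
have g0 : 0 <= gamma by rewrite invr_ge0 mulr_ge0 ?sqr_ge0.
have := mean_leD (mean_leD (hv t.+1%:R X Z) (has_mean_mean_le
  (has_meanD (mean_next_X l t.+1%:R X Z) (mean_next_Z l' t.+1%:R X Z))))
  (has_mean_mean_le (has_mean_cst P (K * wsum cumul_kernel (weights n)))).
move=> /(mean_leZ g0)/(mean_leD (has_mean_mean_le (has_mean_cst P min_risk))).
move=> [m hm mle].
apply: (@le_trans _ _ m%:E).
  rewrite -(has_mean_integral hm); apply: integral_mono => z.
  by have := hl (next_X t.+1%:R X Z z) (next_Z t.+1%:R X Z z); rewrite addSn.
rewrite lee_fin; apply: le_trans mle _; rewrite lerD2l; apply: ler_wpM2l => //.
rewrite [weights n.+1]/= wsum_cons (eq_wsum _ cumul_kernelS) wsumD.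
rewrite cumul_kernel0 mulr0 add0r -/K.
rewrite !(dotDl, dotNl, dotZl).
have tn : t.+1%:R ^+ 2 <= (t + n).+1%:R ^+ 2 :> R.
  by rewrite ler_sqr ?nnegrE// ler_nat ltnS leq_addr.
have k0 : 0 <= sigma ^+ 2 * wsum kernel (weights n).
  rewrite mulr_ge0 ?sqr_ge0// sumr_ge0// => k _.
  exact: mulr_ge0 (weights_ge0 _ _) (kernel_ge0 _).
by have := ler_wpM2r k0 tn; rewrite /K; lra.
Qed.

(** * Rates of the averaged dynamics and final constants *)

Lemma det_risk_scale k s X Z :
  det_risk k (s *: X) (s *: Z) = s ^+ 2 * det_risk k X Z.
Proof.
rewrite mulr_sumr; apply: eq_bigr => i _.
by rewrite !dotZr resp_scale exprMn mulrCA.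
Qed.

Lemma value_scale n s X Z : value n (s *: X) (s *: Z) = s ^+ 2 * value n X Z.
Proof. by rewrite -wsumZ; apply: eq_wsum => k; rewrite det_risk_scale. Qed.

Lemma det_risk_accel k X : det_risk k X X <= 5 / (4 * alpha) * sqnorm X.
Proof.
rewrite -(frame_parseval w_frame) mulr_sumr; apply: ler_sum => i _.
have ab := alpha_small i; have ls := lam_small i.
have := resp_accel halpha hbeta ab (lam_ge0 i) ls k (dot (w i) X) (dot (w i) X).
rewrite /energy subrr expr0n mulr0 addr0.
set r := resp _ _ _ _ _ _ ^+ 2 => h.
have r0 : 0 <= alpha * lam i * r.
  by apply: mulr_ge0 (sqr_ge0 _); apply: mulr_ge0 => //; exact: ltW.
(* Since [2 * alpha <= beta], [5 * alpha <= alpha + 2 * beta]. Hence [1 - alpha * lam i >= 4 / 5],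
   the origin of the constant [5 / 4]. *)
have al : alpha * lam i <= 1 / 5.
  by have := ler_wpM2r (lam_ge0 i) ab; move: ls; rewrite mulrDl; lra.
rewrite [leRHS]mulrAC ler_pdivlMr ?mulr_gt0//.
by have := ler_wpM2r r0 al; lra.
Qed.

Lemma det_risk_damped k X : det_risk k X X <= k.+1%:R / beta * sqnorm X.
Proof.
rewrite -(frame_parseval w_frame) mulr_sumr; apply: ler_sum => i _.
have ab := alpha_small i; have ls := lam_small i.
have bl : beta * lam i <= 1 / 2.
  have := mulr_ge0 (ltW halpha) (lam_ge0 i).
  by move: ls; rewrite mulrDl; lra.
have := @resp_damped _ alpha beta halpha hbeta ab _ (lam_ge0 i) ls k 0 1 1.
rewrite /energy subrr expr0n mulr0 addr0 expr1n normr0 mulr0 add0r.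
move=> /(_ (lexx _) (lexx _)) h.
have {h} h : beta * lam i * resp alpha beta (lam i) k 1 1 ^+ 2 <= k.+1%:R.
  by apply: h; lra.
rewrite -[dot (w i) X]mulr1 resp_scale mulr1 exprMn.
rewrite [leRHS]mulrAC ler_pdivlMr//.
by have := ler_wpM2r (sqr_ge0 (dot (w i) X)) h; lra.
Qed.

Lemma value_le n X c : (forall k, (k <= n)%N -> det_risk k X X <= c) ->
  value n X X <= 3 * c.
Proof.
move=> hc; have c0 : 0 <= c.
  by apply: le_trans (hc 0%N _); rewrite ?det_risk_ge0.
apply: (@le_trans _ _ (wsum (fun=> c * 1) (weights n))).
  apply: ler_wsum => [k|k]; first exact: weights_ge0.
  by rewrite size_weights ltnS mulr1; exact: hc.
by rewrite wsumZ mulrC ler_wpM2r// weights_total_le.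
Qed.

Lemma value_min n X :
  value n X X <= 3 * (Num.min (5 / (4 * alpha)) (n.+1%:R / beta) * sqnorm X).
Proof.
apply: value_le => k kn; rewrite minEle; case: ifP => _.
  exact: det_risk_accel.
apply: le_trans (det_risk_damped k X) _; rewrite ler_wpM2r ?sqnorm_ge0//.
by rewrite ler_wpM2r ?invr_ge0 ?(ltW hbeta)// ler_nat ltnS.
Qed.

(* The affine part [l] of the bound is not computed: since the excess risk is
   nonnegative from every starting point, evaluating the bound at [-X / 3]
   shows that [l] is at most a third of the quadratic part plus three times
   the constant. *)
Lemma run_risk_start n X : (run_risk n 0 X X <= (min_risk +
  (2 * n.+1%:R ^+ 2)^-1 * (4 / 3 * value n X X
     + 4 * (sigma ^+ 2 * n%:R ^+ 2 * noise_level)))%:E)%E.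
Proof.
have [l [l' h]] := run_risk_le n 0; rewrite add0n in h.
have := le_trans (run_risk_ge n 0 ((- 3^-1) *: X) ((- 3^-1) *: X)) (h _ _).
rewrite lee_fin lerDl value_scale !dotZr.
have g0 : 0 < (2 * n.+1%:R ^+ 2)^-1 :> R.
  by rewrite invr_gt0 mulr_gt0 ?exprn_gt0 ?ltr0n.
rewrite pmulr_rge0// => hl.
apply: le_trans (h X X) _; rewrite lee_fin lerD2l ler_pM2l//.
have c0 : 0 <= sigma ^+ 2 * n%:R ^+ 2 :> R by rewrite mulr_ge0 ?sqr_ge0.
by have := ler_wpM2l c0 (weights_cumul_le n); lra.
Qed.

(** The affine term costs [4 / 3] and the weights cost 3, which gives $5/(2 \alpha (t+1)^2)$ and
    $2/(\beta (t+1))$, within the stated constants. The noise term carries an extra factor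
    $(t/(t+1))^2 \le 1$. *)
Lemma last_iterate_bound t X : (1 <= t)%N ->
  (run_risk t 0 X X <= (min_risk +
    (Num.min (3 / (alpha * t%:R ^+ 2)) (24 / (beta * t%:R)) * sqnorm X
       + 2 * noise_level * sigma ^+ 2))%:E)%E.
Proof.
move=> t1; apply: le_trans (run_risk_start t X) _.
have t0 : 0 < t%:R :> R by rewrite ltr0n.
have u0 : 0 < t.+1%:R :> R by rewrite ltr0n.
have t2 : 0 < t%:R ^+ 2 :> R by rewrite exprn_gt0.
have u2 : 0 < t.+1%:R ^+ 2 :> R by rewrite exprn_gt0.
have tu : t%:R <= t.+1%:R :> R by rewrite ler_nat.
have tu2 : t%:R ^+ 2 <= t.+1%:R ^+ 2 :> R by rewrite ler_sqr ?nnegrE.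
have s0 := sqnorm_ge0 X.
have ga0 : 0 <= (2 * t.+1%:R ^+ 2)^-1 :> R.
  by rewrite invr_ge0; apply: mulr_ge0 => //; exact: ltW.
have v c : Num.min (5 / (4 * alpha)) (t.+1%:R / beta) <= c ->
    (2 * t.+1%:R ^+ 2)^-1 * (4 / 3 * value t X X)
      <= (2 * t.+1%:R ^+ 2)^-1 * (4 * (c * sqnorm X)).
  move=> mc; apply: ler_wpM2l => //.
  by have := value_min t X; have := ler_wpM2r s0 mc; lra.
rewrite lee_fin lerD2l mulrDr; apply: lerD; last first.
  rewrite (_ : _ * (4 * _) = 2 * noise_level * sigma ^+ 2
    * (t%:R ^+ 2 / t.+1%:R ^+ 2)); last by field; rewrite gt_eqF.
  rewrite ler_piMr ?ler_pdivrMr ?mul1r//.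
  by rewrite mulr_ge0 ?sqr_ge0// mulr_ge0 ?noise_level_ge0.
rewrite minr_pMl// le_min; apply/andP; split.
  apply: le_trans (v (5 / (4 * alpha)) _) _; first by rewrite ge_min lexx.
  rewrite (_ : _ * (4 * _) = 5 / 2 * (sqnorm X / alpha) * (t.+1%:R ^+ 2)^-1);
    last by field; rewrite !gt_eqF.
  rewrite (_ : 3 / _ * _ = 3 * (sqnorm X / alpha) * (t%:R ^+ 2)^-1);
    last by field; rewrite !gt_eqF.
  have sa : 0 <= sqnorm X / alpha by rewrite divr_ge0// ltW.
  apply: ler_pM; [exact: mulr_ge0 | by rewrite invr_ge0 ltW | lra |].
  by rewrite lef_pV2.
apply: le_trans (v (t.+1%:R / beta) _) _; first by rewrite ge_min lexx orbT.
rewrite (_ : _ * (4 * _) = 2 * (sqnorm X / beta) * t.+1%:R^-1);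
  last by field; rewrite !gt_eqF.
rewrite (_ : 24 / _ * _ = 24 * (sqnorm X / beta) * t%:R^-1);
  last by field; rewrite !gt_eqF.
have sb : 0 <= sqnorm X / beta by rewrite divr_ge0// ltW.
apply: ler_pM; [exact: mulr_ge0 | by rewrite invr_ge0 ltW | lra |].
by rewrite lef_pV2.
Qed.

End LeastSquares.

Theorem theorem3 (R : realType) (d : nat) (dT : measure_display)
  (T : measurableType dT) (P : probability T R)
  (A : T -> 'rV[R]_d) (B : T -> R)
  (hA : forall i : 'I_d, measurable_fun setT (fun z => A z 0 i))
  (hB : measurable_fun setT B)
  (ha2 : (\int[P]_(z in setT) (sqnorm (A z))%:E < +oo)%E)
  (hb2 : (\int[P]_(z in setT) (B z ^+ 2)%:E < +oo)%E)
  (hH : Hmat P A \in unitmx)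
  (xstar : 'rV[R]_d)
  (hxstar : forall x, (risk P A B xstar <= risk P A B x)%E)
  (sigma kappa : R)
  (hsigma : forall v : 'rV[R]_d,
     (\int[P]_(z in setT) ((B z - dot xstar (A z)) ^+ 2 * dot v (A z) ^+ 2)%:E
       <= (sigma ^+ 2 * (v *m Hmat P A *m v^T) 0 0)%:E)%E)
  (hkappa : forall M : 'M[R]_d, psd M -> forall v : 'rV[R]_d,
     (\int[P]_(z in setT) (dot (A z) (A z *m M) * dot v (A z) ^+ 2)%:E
       <= (kappa * \tr (M *m Hmat P A) * (v *m Hmat P A *m v^T) 0 0)%:E)%E)
  (alpha beta : R) (halpha : 0 < alpha) (hbeta : 0 < beta)
  (hstep1 : kappa * (alpha + 2 * beta) * \tr (Hmat P A) <= 1)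
  (hstep2 : alpha * (2 * kappa * d%:R) <= beta)
  (x0 : 'rV[R]_d) (t : nat) (ht : (1 <= t)%N) :
  (Eiter P t (fun s => risk P A B
       (acsgd alpha beta x0 [seq (A z, B z) | z <- s]))
     - risk P A B xstar
   <= (Num.min (3 / (alpha * t%:R ^+ 2)) (24 / (beta * t%:R))
         * sqnorm (x0 - xstar)
       + 2 * ((alpha + 2 * beta) * \tr (Hmat P A)
              + 2 * alpha * d%:R / beta) * sigma ^+ 2)%:E)%E.
Proof.
have [w [lam [ew fw lam0 lamH]]] := psd_eigenframe (Hmat_psd hA ha2).
have := last_iterate_bound hA hB ha2 hb2 hxstar hsigma hkappa ew fw lam0 lamH hH
  halpha hbeta hstep1 hstep2 (x0 - xstar) ht.
have -> : risk P A B xstar = (min_risk P A B xstar)%:E.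
  rewrite -{1}(addr0 xstar) (risk_excess hA hB ha2 hb2 hxstar).
  by rewrite !mul0mx mxE mulr0 add0r.
(* At time 0 the scaling is 1 and $z_0 = x_0$, so both state variables equal [x0 - xstar]. *)
rewrite /run_risk invr1 scale1r addrC subrK => h.
by rewrite leeBlDr// addeC -EFinD.
Qed.
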